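(* Let $n\ge 0$, let $\Pi=\{0,1,\dots,n\}$, and let $\mathcal{A}$ be any superset-closed adversary on $\Pi$, with associated formula $\Phi$. Then for every positive integer $k<\mathit{csize}(\mathcal{A})$, $\Phi$ is valid in $\mathcal{I}[\mathcal{SA}_k]$: $\mathcal{I}[\mathcal{SA}_k],w\models\Phi$ for every world $w$ of $\mathcal{I}[\mathcal{SA}_k]$.
   Context: Adversaries. A superset-closed adversary is a nonempty set $\mathcal{A}\subseteq 2^{\Pi}$ with $\emptyset\notin\mathcal{A}$ such that $P\in\mathcal{A}$ and $P\subseteq P'\subseteq\Pi$ imply $P'\in\mathcal{A}$. A survivor set is an inclusion-minimal element of $\mathcal{A}$. A core is an inclusion-minimal set $C\subseteq\Pi$ with $C\cap P\neq\emptyset$ for every $P\in\mathcal{A}$; $\mathit{csize}(\mathcal{A})$ is the minimum cardinality of a core. Epistemic logic. Atomic propositions are $\mathsf{input}_a^v$ for $a,v\in\Pi$. Formulas are built from these with $\vee,\wedge,\neg$ and modal operators $\mathrm{K}_a$ ($a\in\Pi$), $\mathrm{D}_A$ ($A\subseteq\Pi$). In a Kripke model with worlds $W$, equivalence relations $\sim_a$ ($a\in\Pi$) and labelling $L$ assigning to each world the set of true atomic propositions: $w\models p$ iff $p\in L(w)$ for atomic $p$; propositional connectives are as usual; $w\models\mathrm{K}_a\varphi$ iff $w'\models\varphi$ for all $w'$ with $w\sim_a w'$; $w\models\mathrm{D}_A\varphi$ iff $w'\models\varphi$ for all $w'$ such that $w\sim_a w'$ for every $a\in A$. $\mathsf{false}$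 is the constantly false formula, and empty disjunctions are $\mathsf{false}$. The model $\mathcal{I}[\mathcal{SA}_k]$ ($k$-set agreement task). Worlds are $X\times\vec d$ where $X=\{(0,v_0),\dots,(n,v_n)\}$ with all $v_a\in\Pi$, and $\vec d=\langle d_0,\dots,d_n\rangle\in\Pi^{n+1}$ satisfies $|\{d_0,\dots,d_n\}|\le k$ and, for every $a\in\Pi$, $d_a\in\{v_0,\dots,v_n\}$. Labelling: $L(X\times\vec d)=\{\mathsf{input}_a^v\mid(a,v)\in X\}$. Relations: $X\times\vec d\sim_a Y\times\vec d'$ iff process $a$ has the same input in $X$ and $Y$ and $d_a=d'_a$. The formula $\Phi$. For $A\subseteq\Pi$, define by induction on $A$ with respect to reverse inclusion (starting from $A=\Pi$): $$\psi_A=\bigvee_{a\in\Pi\setminus A}\neg\mathsf{input}_a^a\ \vee\ \bigvee_{a\in\Pi\setminus A}\mathrm{K}_a\Bigl(\bigvee_{j\in A}\bigvee_{a'\in\Pi}\mathsf{input}_{a'}^j\Bigr)\ \vee\ \bigvee_{A\subsetneq B\subseteq\Pi}\Psi_B,$$ and $\Psi_A=\mathsf{false}$ if $\Pi\setminus A$ contains no survivor set as a subset, $\Psi_A=\mathrm{D}_A\psi_A$ otherwise. With $c=\mathit{csize}(\mathcal{A})$, $$\Phi=\bigvee_{a\in\Pi}\neg\mathsf{input}_a^a\ \vee\bigvee_{A\subseteq\Pi,\ 0<|A|<c}\Psi_A.$$ *)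

(* Defs.v *)
From HB Require Import structures.
From mathcomp Require Import all_boot.

Set Implicit Arguments.
Unset Strict Implicit.
Unset Printing Implicit Defensive.

(* T is the finite set of processes; it doubles as the set of input and
   decision values. *)

Definition superset_closed_adversary (T : finType) (Adv : {set {set T}}) : Prop :=
  [/\ Adv != set0, set0 \notin Adv &
      forall P P' : {set T}, P \in Adv -> P \subset P' -> P' \in Adv].

Definition survivor_set (T : finType) (Adv : {set {set T}}) (S : {set T}) : bool :=
  minset [in Adv] S.

Definition core (T : finType) (Adv : {set {set T}}) (C : {set T}) : bool :=
  minset [pred C : {set T} | [forall P in Adv, C :&: P != set0]] C.

(* The default value #|T| of the minimum bounds the size of every core, and a
   core exists as soon as set0 \notin Adv: see csize_min and csize_attained. *)
Definition csize (T : finType) (Adv : {set {set T}}) : nat :=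
  \big[minn/#|T|]_(C : {set T} | core Adv C) #|C|.

Lemma csize_min (T : finType) (Adv : {set {set T}}) (C : {set T}) :
  core Adv C -> csize Adv <= #|C|.
Proof.
rewrite /csize => coreC; elim: (index_enum _) (mem_index_enum C) => //= D s IHs.
rewrite inE big_cons => /predU1P[<-|/IHs le_s]; first by rewrite coreC geq_minl.
by case: ifP => // _; rewrite geq_min le_s orbT.
Qed.

Lemma csize_attained (T : finType) (Adv : {set {set T}}) :
  set0 \notin Adv -> exists2 C, core Adv C & #|C| = csize Adv.
Proof.
move=> Adv0.
have hitT: [pred C : {set T} | [forall P in Adv, C :&: P != set0]] [set: T].
  by apply/forall_inP=> P AdvP; rewrite setTI; apply: contraNneq Adv0 => <-.
have [C0 coreC0 _] := minset_exists hitT.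
have [/=|eq_c] : (exists2 C, core Adv C & #|C| = csize Adv) \/ csize Adv = #|T|.
- rewrite /csize; elim/big_rec: _ => [|D m coreD IHm]; first by right.
  by rewrite /minn; case: ltnP => _ //; left; exists D.
- by [].
exists C0 => //; apply/eqP; rewrite eqn_leq csize_min // andbT eq_c.
exact: max_card.
Qed.

Inductive formula (T : finType) : Type :=
| Input of T & T (* Input a v is the atom input_a^v *)
| FFalse
| FNot of formula T
| FOr of formula T & formula T
| FAnd of formula T & formula T
| FK of T & formula T
| FD of {set T} & formula T.

Arguments FFalse {T}.

Record kripke (T : finType) : Type := Kripke {
  world : Type;
  indist : T -> rel world;
  indist_equiv : forall a, equivalence_rel (indist a);
  (* (a, v) \in label w when the atom input_a^v is true at w *)
  label : world -> {set T * T}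
}.

Arguments indist {T} _ a.
Arguments label {T} _ w.

Fixpoint sat (T : finType) (M : kripke T) (w : world M) (phi : formula T) : Prop :=
  match phi with
  | Input a v => (a, v) \in label M w
  | FFalse => False
  | FNot phi1 => ~ sat w phi1
  | FOr phi1 phi2 => sat w phi1 \/ sat w phi2
  | FAnd phi1 phi2 => sat w phi1 /\ sat w phi2
  | FK a phi1 => forall w' : world M, indist M a w w' -> sat w' phi1
  | FD A phi1 =>
      forall w' : world M, (forall a, a \in A -> indist M a w w') -> sat w' phi1
  end.

(* A world X x d is encoded by the pair of functions (a |-> v_a, a |-> d_a). *)
Definition is_sa_world (T : finType) (k : nat)
    (w : {ffun T -> T} * {ffun T -> T}) : bool :=
  (#|[set w.2 a | a : T]| <= k) && [forall a, w.2 a \in [set w.1 b | b : T]].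

Definition sa_world (T : finType) (k : nat) : Type :=
  {w : {ffun T -> T} * {ffun T -> T} | is_sa_world k w}.

Definition sa_input (T : finType) (k : nat) (w : sa_world T k) (a : T) : T :=
  (val w).1 a.

Definition sa_decision (T : finType) (k : nat) (w : sa_world T k) (a : T) : T :=
  (val w).2 a.

Definition sa_indist (T : finType) (k : nat) (a : T) : rel (sa_world T k) :=
  fun w w' => (sa_input w a == sa_input w' a)
              && (sa_decision w a == sa_decision w' a).

Definition sa_label (T : finType) (k : nat) (w : sa_world T k) : {set T * T} :=
  [set (a, sa_input w a) | a : T].

Lemma sa_indist_equiv (T : finType) (k : nat) (a : T) :
  equivalence_rel (@sa_indist T k a).
Proof.
move=> x y z; rewrite /sa_indist !eqxx; split=> //.
by case/andP=> /eqP-> /eqP->.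
Qed.

Definition set_agreement_model (T : finType) (k : nat) : kripke T :=
  Kripke (@sa_indist_equiv T k) (@sa_label T k).

Definition has_survivor_outside (T : finType) (Adv : {set {set T}})
    (A : {set T}) : bool :=
  [exists S : {set T}, survivor_set Adv S && (S \subset ~: A)].

Definition psi_body (T : finType) (Psi : {set T} -> formula T) (A : {set T}) :
    formula T :=
  FOr (\big[@FOr T/FFalse]_(a in ~: A) FNot (Input a a))
   (FOr (\big[@FOr T/FFalse]_(a in ~: A)
           FK a (\big[@FOr T/FFalse]_(j in A)
                   \big[@FOr T/FFalse]_(a' : T) Input a' j))
        (\big[@FOr T/FFalse]_(B : {set T} | A \proper B) Psi B)).

(* The recursion on A for reverse inclusion is run with fuel m; any m > #|~: A|
   is enough. The intended recursive equation is PsiE. *)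
Fixpoint Psi_rec (T : finType) (Adv : {set {set T}}) (m : nat) (A : {set T}) :
    formula T :=
  if m is m'.+1 then
    if has_survivor_outside Adv A then FD A (psi_body (Psi_rec Adv m') A) else FFalse
  else FFalse.

Definition Psi (T : finType) (Adv : {set {set T}}) (A : {set T}) : formula T :=
  Psi_rec Adv #|~: A|.+1 A.

Definition psi (T : finType) (Adv : {set {set T}}) (A : {set T}) : formula T :=
  psi_body (Psi Adv) A.

Lemma Psi_rec_fuel (T : finType) (Adv : {set {set T}}) (m : nat) (A : {set T}) :
  #|~: A| < m -> Psi_rec Adv m A = Psi Adv A.
Proof.
suff eq_rec p B : #|~: B| < p -> #|~: B| < m -> Psi_rec Adv m B = Psi_rec Adv p B.
  by move=> ltm; apply: eq_rec ltm.
elim: m p B => // m IHm [|p] {}A //= ltp ltm.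
case: ifP => // _; congr (FD A (FOr _ (FOr _ _))).
apply: eq_bigr => B ltAB; have ltBA: #|~: B| < #|~: A|.
  by rewrite proper_card // properC.
by apply: IHm; apply: leq_trans ltBA _.
Qed.

Lemma PsiE (T : finType) (Adv : {set {set T}}) (A : {set T}) :
  Psi Adv A = if has_survivor_outside Adv A then FD A (psi Adv A) else FFalse.
Proof.
rewrite {1}/Psi /=; case: ifP => // _; congr (FD A (FOr _ (FOr _ _))).
apply: eq_bigr => B ltAB; apply: Psi_rec_fuel.
by rewrite proper_card // properC.
Qed.

Definition Phi (T : finType) (Adv : {set {set T}}) : formula T :=
  FOr (\big[@FOr T/FFalse]_(a : T) FNot (Input a a))
      (\big[@FOr T/FFalse]_(A : {set T} | 0 < #|A| < csize Adv) Psi Adv A).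

(* Main.v *)
Require Import Defs.
From mathcomp Require Import all_boot.

Set Implicit Arguments.
Unset Strict Implicit.
Unset Printing Implicit Defensive.

(** At a world whose inputs are the identity, a nonempty set [A] that the
    decision map maps onto itself satisfies [Psi A]; such an [A] exists, for
    instance a minimal nonempty set stable under the decision map. The proof is
    by reverse induction on [A]. Since [A] consists of decision values,
    [#|A| <= k], so [A] contains no core and a survivor set lies outside [A].
    Now move to a world that the processes of [A] do not distinguish from the
    current one; there the new decision map still maps [A] onto [A]. Either some
    process outside [A] has a foreign input, or some process outside [A] decides
    a value of [A] and hence knows that this value is an input, or the
    complement of [A] is stable under the decision map. In the last case a
    minimal nonempty stable subset [Y] of the complement is mapped onto itself,
    and the induction hypothesis applies to [A :|: Y]. *)

(** The image of a nonempty stable set is again nonempty and stable, so a minimal one equals its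
    image. *)
Lemma stable_sub_fixed (T : finType) (f : T -> T) (X : {set T}) :
  X != set0 -> f @: X \subset X ->
  exists Y : {set T}, [/\ Y != set0, Y \subset X & f @: Y = Y].
Proof.
move=> X0 fX.
have [|Y /minsetP[/andP[Y0 fY] minY] subYX] :=
  @minset_exists T [pred Y : {set T} | (Y != set0) && (f @: Y \subset Y)] X.
  by rewrite /= X0.
exists Y; split=> //; apply: minY => //=.
by rewrite imset_eq0 Y0 /= imsetS.
Qed.

Lemma sat_bigor (T : finType) (M : kripke T) (w : world M) (I : finType)
    (P : pred I) (F : I -> formula T) (i : I) :
  P i -> sat w (F i) -> sat w (\big[@FOr T/FFalse]_(j | P j) F j).
Proof.
move=> Pi Fi; elim: (index_enum I) (mem_index_enum i) => //= j s IHs.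
rewrite inE big_cons => /predU1P[<-|/IHs sat_s]; first by rewrite Pi; left.
by case: ifP => // _; right.
Qed.

Lemma csize_le_card (T : finType) (Adv : {set {set T}}) : csize Adv <= #|T|.
Proof.
by rewrite /csize; elim/big_rec: _ => // C p _ le_p; rewrite geq_min le_p orbT.
Qed.

(** Too small to contain a core, [A] misses some [P] in [Adv]; shrinking [P] gives a survivor
    set. *)
Lemma has_survivor_outside_small (T : finType) (Adv : {set {set T}})
    (A : {set T}) :
  #|A| < csize Adv -> has_survivor_outside Adv A.
Proof.
move=> ltAc.
have : ~~ [forall P in Adv, A :&: P != set0].
  apply: contraL ltAc => hitA; rewrite -leqNgt.
  have [C coreC subCA] :=
    @minset_exists T [pred C : {set T} | [forall P in Adv, C :&: P != set0]]
      A hitA.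
  exact: leq_trans (csize_min coreC) (subset_leq_card subCA).
rewrite negb_forall_in => /exists_inP[P AdvP]; rewrite negbK => /eqP AP0.
have [S minS subSP] := @minset_exists T [in Adv] P AdvP.
apply/existsP; exists S; rewrite /survivor_set minS /=.
apply: subset_trans subSP _.
by rewrite -disjoints_subset -setI_eq0 setIC AP0.
Qed.

Section SetAgreement.

Variables (T : finType) (k : nat).
Implicit Types (w : sa_world T k) (A : {set T}).

Notation M := (set_agreement_model T k).

Lemma sa_labelE w a v : ((a, v) \in sa_label w) = (sa_input w a == v).
Proof.
apply/imsetP/eqP=> [[b _ [-> ->]] //|<-].
by exists a.
Qed.

Lemma card_sa_decision w A : #|sa_decision w @: A| <= k.
Proof.
case/andP: (valP w) => le_k _; apply: leq_trans le_k.
by apply/subset_leq_card/subsetP=> _ /imsetP[a _ ->]; apply: imset_f.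
Qed.

Lemma sa_decision_input w a : exists b, sa_input w b = sa_decision w a.
Proof.
by case/andP: (valP w) => _ /forallP/(_ a)/imsetP[b _ eq_b]; exists b.
Qed.

Lemma sat_own_inputs w (P : pred T) :
  @sat T M w (\big[@FOr T/FFalse]_(a | P a) FNot (Input a a)) \/
  {in P, forall a, sa_input w a = a}.
Proof.
have [/existsP[a /andP[Pa neq_a]] | ] :=
  boolP [exists a, P a && (sa_input w a != a)].
  left; apply: (@sat_bigor T M w _ _ _ a Pa) => /=.
  by rewrite sa_labelE; apply/negP.
rewrite negb_exists => /forallP own; right=> a Pa; apply/eqP.
by move: (own a); rewrite -[P a]/(a \in P) Pa negbK.
Qed.

(** Process [a] keeps its decision in every world it considers possible, and each decision there is
    some input. *)
Lemma sat_knows_decision w A a :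
  sa_decision w a \in A ->
  @sat T M w (FK a (\big[@FOr T/FFalse]_(j in A)
                    \big[@FOr T/FFalse]_(a' : T) Input a' j)).
Proof.
move=> dA w' /andP[_ /eqP eq_d]; apply: (@sat_bigor T M w' _ _ _ _ dA).
have [b eq_b] := sa_decision_input w' a.
by apply: (@sat_bigor T M w' _ _ _ b) => //=; rewrite sa_labelE eq_b eq_d.
Qed.

Lemma sat_Psi (Adv : {set {set T}}) A w :
  k < csize Adv -> A != set0 -> sa_decision w @: A = A ->
  (forall a, sa_input w a = a) -> @sat T M w (Psi Adv A).
Proof.
move=> ltkc.
(* [w] is generalized too, since the induction hypothesis is applied at the new world [w']. *)
have [m] := ubnP #|~: A|; elim: m => // m IHm in A w * => leAm A0 dA own_w.
have ltAc : #|A| < csize Adv.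
  by apply: leq_ltn_trans ltkc; rewrite -dA card_sa_decision.
rewrite PsiE (has_survivor_outside_small ltAc) => w' eq_w.
have dA' : sa_decision w' @: A = A.
  by rewrite -[RHS]dA; apply: eq_in_imset => a /eq_w/andP[_ /eqP].
have [|own'] := sat_own_inputs w' (mem (~: A)); first by left.
have own_w' a : sa_input w' a = a.
  have [aA|aA] := boolP (a \in A); last by apply: own'; rewrite inE.
  by case/andP: (eq_w a aA) => /eqP<- _.
right; have [/exists_inP[a aA da]|] :=
  boolP [exists a in ~: A, sa_decision w' a \in A].
  by left; apply: (@sat_bigor T M w' _ _ _ a aA); apply: sat_knows_decision.
rewrite negb_exists_in => /forall_inP stable; right.
(* Otherwise [#|A| = #|T|], which is at least [csize Adv]. *)
have CA0 : ~: A != set0.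
  apply: contraTneq ltAc => CA0; rewrite -leqNgt -[A]setCK CA0 setC0 cardsT.
  exact: csize_le_card.
have [|Y [Y0 subY dY]] := @stable_sub_fixed _ (sa_decision w') _ CA0.
  by apply/subsetP=> _ /imsetP[a aA ->]; rewrite inE stable.
have ltAY : A \proper A :|: Y.
  rewrite properUl //; have [y yY] := set0Pn _ Y0.
  apply/subsetPn; exists y => //.
  by have := subsetP subY y yY; rewrite inE.
apply: (@sat_bigor T M w' _ (fun B : {set T} => A \proper B) (Psi Adv) _ ltAY).
apply: IHm => //.
- by rewrite -ltnS (leq_trans _ leAm) // ltnS proper_card // properC.
- by rewrite setU_eq0 negb_and A0.
- by rewrite imsetU dA' dY.
Qed.

End SetAgreement.

Theorem proposition4p5 (n : nat) (Adv : {set {set 'I_n.+1}})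
    (hAdv : superset_closed_adversary Adv)
    (k : nat) (hk0 : 0 < k) (hk : k < csize Adv)
    (w : world (set_agreement_model 'I_n.+1 k)) :
  sat w (Phi Adv).
Proof.
have [|own] := sat_own_inputs w xpredT; first by left.
right; have [||A [A0 _ dA]] := @stable_sub_fixed _ (sa_decision w) setT.
- by apply/set0Pn; exists ord0.
- exact: subsetT.
have ltAc : #|A| < csize Adv.
  by apply: leq_ltn_trans hk; rewrite -dA card_sa_decision.
apply: (@sat_bigor _ _ w _ _ _ A); first by rewrite card_gt0 A0.
by apply: sat_Psi => // a; apply: own.
Qed.
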